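(* For an almost space homogeneous event (ASHE) $a$ and any $m\le M$ in $\mathcal{S}$, the envelope transition $[m',M']=[m,M]\boxdot a$ can be computed exactly in $O(d^2)$ elementary operations. Explicitly, with $CR(\cdot)$ and $B(\cdot)$ as below: if $j\notin B(m)\cup B(M)$, then $[m'_j,M'_j]=[(m_j+v_j)\vee 0\wedge C_j,\,(M_j+v_j)\vee 0\wedge C_j]$; if some $i\in CR(m)\cap CR(M)$ has $(i,j)\in\mathcal{R}$, then $[m'_j,M'_j]=[m_j,M_j]$; otherwise, if $j$ is blocked by some $i\neq j$ with $i\in CR(m)\cup CR(M)$, then $[m'_j,M'_j]=[(m_j+v_j)\vee 0,\,M_j]$ when $v_j<0$ and $[m_j,\,(M_j+v_j)\wedge C_j]$ when $v_j>0$; and if only $j$ blocks $j$, then $[m'_j,M'_j]=[0,\,(M_j+v_j)\vee(-v_j-1)]$ when $v_j<0$ and $[(m_j+v_j)\wedge(C_j-v_j+1),\,C_j]$ when $v_j>0$.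
   Context: $\mathcal{S}=[0,C]\subset\mathbb{Z}^d$ with the componentwise product order. For $x,y\in\mathbb{R}^d$, $x\vee y$ and $x\wedge y$ are componentwise max and min, and $x\vee y\wedge z=(x\vee y)\wedge z$. An event $a$ is an ASHE if there is a direction vector $v\in\mathbb{Z}^d$ and a binary blocking relation $\mathcal{R}$ on $\{1,\dots,d\}$ such that, with $CR(x)=\{i: x_i+v_i\notin[0,C_i]\}$ and $B(x)=\{i:\exists j\in CR(x),(j,i)\in\mathcal{R}\}$, one has $(x\cdot a)_i=x_i$ for $i\in B(x)$ and $(x\cdot a)_i=(x_i+v_i)\vee 0\wedge C_i$ otherwise. The envelope transition is $[m,M]\boxdot a=[\inf_{m\le x\le M} x\cdot a,\ \sup_{m\le x\le M} x\cdot a]$, the smallest interval containing $[m,M]\cdot a$. Components with $v_j=0$ are unchanged. *)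

(* Defs.v *)
(* Mathematical Components, with classical_sets for infima and suprema. *)
From mathcomp Require Import all_boot all_order all_algebra.
From mathcomp Require Import classical_sets.
Set Implicit Arguments.
Unset Strict Implicit.
Unset Printing Implicit Defensive.
Import Order.TTheory GRing.Theory Num.Theory.
Local Open Scope classical_set_scope.
Local Open Scope ring_scope.

(** * States, almost space homogeneous events, envelopes *)

(* Z^d; [<=%O] on this type is the componentwise order. *)
Notation vec d := (d.-tupleprod int).
Notation "x .@ i" := (tnth x i) (at level 2, left associativity, format "x .@ i")
  : ring_scope.

Definition vec0 d : vec d := [tuple (0 : int) | _ < d].

Definition states d (C : vec d) : set (vec d) :=
  [set x | (vec0 d <= x <= C)%O].

Section Ashe.
Variables (d : nat) (C v : vec d) (R : rel 'I_d).

(* z \/ 0 /\ c, read as (z \/ 0) /\ c. *)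
Definition clip (z c : int) : int := Num.min (Num.max z 0) c.

Definition CR (x : vec d) : {set 'I_d} :=
  [set i | ~~ (0 <= x.@i + v.@i <= C.@i)]%SET.

Definition B (x : vec d) : {set 'I_d} :=
  [set i | [exists j, (j \in CR x) && R j i]]%SET.

(* [a] is only constrained on the state space; its values elsewhere are
   irrelevant below. *)
Definition ashe (a : vec d -> vec d) : Prop :=
  forall x, states C x -> forall i,
    (a x).@i = if i \in B x then x.@i else clip (x.@i + v.@i) C.@i.

End Ashe.

Definition envelope d (a : vec d -> vec d) (m M m' M' : vec d) : Prop :=
  let img := a @` [set x | (m <= x <= M)%O] in
  infimums img m' /\ supremums img M'.

(** * Elementary operations

  A unit-cost random access machine over the integers, as a structured
  language. The memory consists of tables named by natural numbers, with cells
  indexed by two integers; a vector occupies column 0 of a table and a scalar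
  its cell (0, 0). There is no multiplication. *)

Definition memory := nat -> int -> int -> int.

Definition upd (s : memory) (t : nat) (i j z : int) : memory :=
  fun t' i' j' => if [&& t' == t, i' == i & j' == j] then z else s t' i' j'.

Inductive binop := Add | Sub | Min | Max | Leq.

Inductive expr :=
  | Cst of int
  | Cell of nat & expr & expr
  | Bin of binop & expr & expr.

Inductive cmd :=
  | Skip
  | Set_ of nat & expr & expr & expr
  | Seq of cmd & cmd
  | If of expr & cmd & cmd
  | For of nat & expr & cmd.

Definition binop_eval (o : binop) (x y : int) : int :=
  match o with
  | Add => x + y
  | Sub => x - y
  | Min => Num.min x y
  | Max => Num.max x y
  | Leq => if x <= y then 1 else 0
  end.

Fixpoint eval (s : memory) (e : expr) : int :=
  match e with
  | Cst z => z
  | Cell t i j => s t (eval s i) (eval s j)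
  | Bin o e1 e2 => binop_eval o (eval s e1) (eval s e2)
  end.

(* Every constant, table access and arithmetic operation counts for one. *)
Fixpoint ecost (e : expr) : nat :=
  match e with
  | Cst _ => 1
  | Cell _ i j => (ecost i + ecost j).+1
  | Bin _ e1 e2 => (ecost e1 + ecost e2).+1
  end.

(* The final memory and the number of elementary operations performed. The loop
   [For x e c] evaluates [e] once, to n, and runs [c] for each k = 0, ..., n - 1
   (not at all if n <= 0), having stored k in cell (0, 0) of table [x]; every
   assignment, branching and loop step counts for one, in addition to the
   expressions and commands that it executes. *)
Fixpoint exec (c : cmd) (s : memory) : memory * nat :=
  match c with
  | Skip => (s, 1%N)
  | Set_ t i j e =>
      (upd s t (eval s i) (eval s j) (eval s e),
       (ecost i + ecost j + ecost e).+1)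
  | Seq c1 c2 =>
      let: (s1, n1) := exec c1 s in
      let: (s2, n2) := exec c2 s1 in
      (s2, (n1 + n2)%N)
  | If e c1 c2 =>
      let: (s1, n1) := if eval s e != 0 then exec c1 s else exec c2 s in
      (s1, (n1 + ecost e).+1)
  | For x e c1 =>
      let n := if eval s e is Posz n then n else 0%N in
      foldl (fun st k =>
               let: (s1, n1) := exec c1 (upd st.1 x 0 0 k%:Z) in
               (s1, (st.2 + n1).+1))
            (s, (ecost e).+1) (iota 0 n)
  end.

Definition tab_dim : nat := 0.
Definition tab_C : nat := 1.
Definition tab_v : nat := 2.
Definition tab_R : nat := 3.
Definition tab_m : nat := 4.
Definition tab_M : nat := 5.
Definition tab_m' : nat := 6.
Definition tab_M' : nat := 7.

Definition stores d (s : memory) (t : nat) (x : vec d) : Prop :=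
  forall i : 'I_d, s t i%:Z 0 = x.@i.

(* The contents of all the other cells are arbitrary. *)
Definition input d (C v : vec d) (R : rel 'I_d) (m M : vec d) (s : memory) : Prop :=
  [/\ s tab_dim 0 0 = d%:Z,
      stores s tab_C C /\ stores s tab_v v,
      stores s tab_m m /\ stores s tab_M M
    & forall i j : 'I_d, s tab_R i%:Z j%:Z = if R i j then 1 else 0].

(* Main.v *)
(* On a state x, coordinate i can leave [0, C] only in the direction of v_i, so
   it is critical on an upper part of its range if v_i > 0 and on a lower part if
   v_i < 0. Over [m, M], CR(m) :&: CR(M) is therefore the set of the coordinates
   that are always critical, CR(m) :|: CR(M) the set of those that can be, and
   moving each coordinate to one end of its interval makes all the sometimes
   critical ones critical, or all of them non-critical, at once. This is
   independent of x_j except for the effect of j on itself: the j-th component of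
   x.a is x_j for a blocked x and (x_j + v_j) clipped to [0, C_j] for a free one,
   and only if j blocks j do these two cases restrict x_j. The extrema over both
   cases are the explicit formulas. Which formula applies to j is decided by one
   scan over the possible blockers i, hence O(d^2) operations in all. *)
Require Import Defs.
From mathcomp Require Import all_boot all_order all_algebra.
From mathcomp Require Import classical_sets.
From mathcomp Require Import zify.
Set Implicit Arguments.
Unset Strict Implicit.
Unset Printing Implicit Defensive.
Import Order.TTheory GRing.Theory Num.Theory.
Local Open Scope ring_scope.

(** * The envelope of an ASHE *)

Section EnvelopeValues.
Variables (d : nat) (C v : vec d) (R : rel 'I_d) (m M : vec d).

Lemma vec_leP (x y : vec d) :
  reflect (forall i, x.@i <= y.@i) (x <= y)%O.
Proof. by rewrite leEtprod; apply: forallP. Qed.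

Lemma in_CR x i : (i \in CR C v x) = ~~ (0 <= x.@i + v.@i <= C.@i).
Proof. by rewrite inE. Qed.

Lemma in_B x j : (j \in B C v R x) = [exists i, (i \in CR C v x) && R i j].
Proof. by rewrite inE. Qed.

Definition always_blocked j :=
  [exists i, (i \in CR C v m :&: CR C v M) && R i j].

Definition blocked_by_other j :=
  [exists i, (i \in CR C v m :|: CR C v M) && (R i j && (i != j))].

Definition blocked_by_self j := (j \in CR C v m :|: CR C v M) && R j j.

(* The branches with [v.@j <= 0] also give the right values for [v.@j = 0]. *)
Definition lower j : int :=
  if always_blocked j then m.@j
  else if blocked_by_other j then
    if v.@j <= 0 then Num.max (m.@j + v.@j) 0 else m.@j
  else if blocked_by_self j then
    if v.@j <= 0 then 0 else Num.min (m.@j + v.@j) (C.@j - v.@j + 1)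
  else clip (m.@j + v.@j) C.@j.

(** When only j blocks j, [- v.@j - 1] is the largest critical value of x_j for v_j < 0, and
    [C.@j - v.@j + 1] in [lower] is the smallest one for v_j > 0. A critical value is kept, so it
    competes with the clipped ones. *)
Definition upper j : int :=
  if always_blocked j then M.@j
  else if blocked_by_other j then
    if v.@j <= 0 then M.@j else Num.min (M.@j + v.@j) C.@j
  else if blocked_by_self j then
    if v.@j <= 0 then Num.max (M.@j + v.@j) (- v.@j - 1) else C.@j
  else clip (M.@j + v.@j) C.@j.

Variable a : vec d -> vec d.
Hypothesis a_ashe : ashe C v R a.
Hypotheses (m_state : states C m) (M_state : states C M) (le_mM : (m <= M)%O).

Lemma state_bounds j : [/\ 0 <= m.@j, m.@j <= M.@j & M.@j <= C.@j].
Proof.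
case/andP: m_state => /vec_leP/(_ j); rewrite tnth_mktuple => m_ge0 _.
case/andP: M_state => _ /vec_leP le_MC.
by split=> //; apply/vec_leP.
Qed.

Lemma in_CRI i : (i \in CR C v m :&: CR C v M) =
  ~~ (0 <= m.@i + v.@i <= C.@i) && ~~ (0 <= M.@i + v.@i <= C.@i).
Proof. by rewrite inE !in_CR. Qed.

Lemma in_CRU i : (i \in CR C v m :|: CR C v M) =
  ~~ (0 <= m.@i + v.@i <= C.@i) || ~~ (0 <= M.@i + v.@i <= C.@i).
Proof. by rewrite inE !in_CR. Qed.

(** * Bounds valid on the whole interval *)

Section Interval.
Variable x : vec d.
Hypothesis mxM : (m <= x <= M)%O.

Lemma interval_bounds j : m.@j <= x.@j <= M.@j.
Proof. by case/andP: mxM => /vec_leP mx /vec_leP xM; rewrite mx xM. Qed.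

Lemma ashe_interval j :
  (a x).@j = if j \in B C v R x then x.@j else clip (x.@j + v.@j) C.@j.
Proof.
apply: a_ashe; apply/andP; split; apply/vec_leP => i;
  have [m0 _ MC] := state_bounds i; have /andP[mx xM] := interval_bounds i.
- by rewrite tnth_mktuple; apply: le_trans mx.
- exact: le_trans MC.
Qed.

(** A state can leave [0, C_i] only on the side given by the sign of v_i; if both ends do, so does
    every value between them. *)
Lemma CRI_sub i : i \in CR C v m :&: CR C v M -> i \in CR C v x.
Proof.
rewrite in_CRI in_CR.
have [? ? ?] := state_bounds i; have := interval_bounds i; lia.
Qed.

(** If x_i leaves [0, C_i], so does the end of its interval that lies further in the direction of
    v_i. *)
Lemma CR_subU i : i \in CR C v x -> i \in CR C v m :|: CR C v M.
Proof.
rewrite in_CRU in_CR.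
have [? ? ?] := state_bounds i; have := interval_bounds i; lia.
Qed.

Lemma always_blocked_B j : always_blocked j -> j \in B C v R x.
Proof.
case/existsP=> i /andP[iCR Rij]; rewrite in_B.
by apply/existsP; exists i; rewrite CRI_sub.
Qed.

(** By [CR_subU], a blocker of j at x can only be j; whether j is blocked then depends on x_j
    alone. *)
Lemma B_by_self j : ~~ blocked_by_other j ->
  (j \in B C v R x) = (j \in CR C v x) && R j j.
Proof.
move=> not_other; rewrite in_B; apply/existsP/idP => [[i]|]; last by exists j.
have [-> // | neq_ij] := eqVneq i j => /andP[iCR Rij].
by case/negP: not_other; apply/existsP; exists i; rewrite CR_subU ?Rij.
Qed.

Lemma ashe_in_bounds j : lower j <= (a x).@j <= upper j.
Proof.
rewrite ashe_interval /lower /upper.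
have [? ? ?] := state_bounds j; have := interval_bounds j.
case: ifPn => [/always_blocked_B -> // | _].
case: ifPn => [_ | /B_by_self ->]; rewrite /clip.
  (* The unchanged and the clipped value both lie within the bounds. *)
  by case: (j \in _); case: (lerP v.@j 0); lia.
rewrite /blocked_by_self in_CRU in_CR.
case: (R j j); rewrite ?andbT ?andbF; last by lia.
by do 4?[case: ifP => ?]; lia.
Qed.

End Interval.

(** * Attainment of the bounds *)

Definition replace j (z : int) (w : 'I_d -> int) : vec d :=
  [tuple if i == j then z else w i | i < d].

Lemma replace_interval j z w :
    m.@j <= z <= M.@j -> (forall i, m.@i <= w i <= M.@i) ->
  (m <= replace j z w <= M)%O.
Proof.
move=> zP wP; apply/andP; split; apply/vec_leP => i; rewrite tnth_mktuple;
by case: eqP => [-> | _]; [case/andP: zP | case/andP: (wP i)].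
Qed.

(** Yields the extrema reached at blocked states. Since the interval is a product, x_j = z can be
    prescribed while the other coordinates are moved; if j is to be its own blocker, z must be
    critical. *)
Lemma attained_blocked j z : m.@j <= z <= M.@j ->
    blocked_by_other j || (R j j && ~~ (0 <= z + v.@j <= C.@j)) ->
  exists2 x, (m <= x <= M)%O & (a x).@j = z.
Proof.
move=> zP block.
(* Every coordinate but j is moved to the end where it is critical, if any. *)
pose w i := if i \in CR C v m then m.@i else M.@i.
have xP : (m <= replace j z w <= M)%O.
  apply: replace_interval => // i; rewrite /w.
  by have [? ? ?] := state_bounds i; case: ifP => _; lia.
exists (replace j z w) => //; rewrite ashe_interval //.
suff -> : j \in B C v R (replace j z w) by rewrite tnth_mktuple eqxx.
rewrite in_B; apply/existsP; case/orP: block => [/existsP[i] | /andP[Rjj zCR]].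
  case/and3P=> iCR Rij neq_ij; exists i; rewrite Rij andbT.
  rewrite in_CR tnth_mktuple (negPf neq_ij) /w.
  by move: iCR; rewrite finset.in_setU !in_CR; case: (boolP (_ <= _ <= _)).
by exists j; rewrite Rjj in_CR tnth_mktuple eqxx zCR.
Qed.

(** Yields the extrema reached at free states. As j is not always blocked, each i with [R i j] has a
    non-critical end; the implication handles i = j, whose value z is prescribed. *)
Lemma attained_free j z y : ~~ always_blocked j -> m.@j <= z <= M.@j ->
    (R j j ==> (0 <= z + v.@j <= C.@j)) -> clip (z + v.@j) C.@j = y ->
  exists2 x, (m <= x <= M)%O & (a x).@j = y.
Proof.
move=> not_always zP free <-.
(* Every coordinate but j is moved to the end where it is not critical, if any. *)
pose w i := if i \in CR C v m then M.@i else m.@i.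
have xP : (m <= replace j z w <= M)%O.
  apply: replace_interval => // i; rewrite /w.
  by have [? ? ?] := state_bounds i; case: ifP => _; lia.
exists (replace j z w) => //; rewrite ashe_interval //.
suff /negPf -> : j \notin B C v R (replace j z w) by rewrite tnth_mktuple eqxx.
rewrite in_B; apply: contra not_always => /existsP[i] /andP[].
rewrite in_CR tnth_mktuple; case: eqP => [-> zCR Rjj | _ wCR Rij].
  by move: free; rewrite Rjj (negPf zCR).
apply/existsP; exists i; rewrite Rij andbT.
by move: wCR; rewrite /w finset.in_setI !in_CR; case: ifPn => [_ -> | /negPn ->].
Qed.

(** If the permanent blocker is j itself, z is critical because both ends are; otherwise it is
    another blocker for [attained_blocked]. *)
Lemma attained_always j z : always_blocked j -> m.@j <= z <= M.@j ->
  exists2 x, (m <= x <= M)%O & (a x).@j = z.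
Proof.
move=> alw zP; have := alw; case/existsP=> i /andP[iCR Rij].
apply: attained_blocked => //; apply/orP; have [eq_ij | neq_ij] := eqVneq i j.
  right; rewrite -[in R _]eq_ij Rij -eq_ij; move: zP iCR; rewrite in_CRI -eq_ij.
  by have [? ? ?] := state_bounds i; lia.
left; apply/existsP; exists i; rewrite Rij neq_ij finset.in_setU.
by move: iCR; rewrite finset.in_setI => /andP[->].
Qed.

(** Ensures that the non-critical witnesses chosen below lie in [m_j, M_j]. *)
Lemma not_always_self j : ~~ always_blocked j -> R j j ->
  (0 <= m.@j + v.@j <= C.@j) || (0 <= M.@j + v.@j <= C.@j).
Proof.
move=> not_always Rjj; apply: contraR not_always; rewrite negb_or => jCR.
by apply/existsP; exists j; rewrite in_CRI jCR.
Qed.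

Lemma lower_attained j : exists2 x, (m <= x <= M)%O & (a x).@j = lower j.
Proof.
have [m0 mM MC] := state_bounds j; rewrite /lower.
case: ifPn => [alw | not_always]; first by apply: attained_always => //; lia.
have self := not_always_self not_always.
case: ifPn => [other | not_other].
  case: ifPn => v_sgn; last by apply: attained_blocked; rewrite ?other //; lia.
  (* When j blocks j, the least non-critical value of the interval; by [self] it is at most M_j. *)
  apply: (attained_free (z := if R j j then Num.max m.@j (- v.@j) else m.@j)) => //;
  by move: self; rewrite /clip; case: (R j j) => [/(_ isT)|]; lia.
case: ifPn => [/andP[jCR Rjj] | not_self].
  (* Exactly one end is critical, so the interval contains both values next to the threshold: -v_j -
     1 and -v_j, or C_j - v_j and C_j - v_j + 1. *)
  move: jCR (self Rjj); rewrite in_CRU => jCR jCR'; case: ifPn => v_sgn.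
    by apply: (attained_free (z := - v.@j)) => //; rewrite /clip; lia.
  (* The minimum is the image of the free m_j or the least blocked value, whichever is smaller. *)
  have [le_mv | lt_mv] := leP (m.@j + v.@j) (C.@j - v.@j + 1).
    by apply: (attained_free (z := m.@j)) => //; rewrite /clip; lia.
  by apply: attained_blocked; rewrite ?Rjj; lia.
apply: (attained_free (z := m.@j)) => //; first by lia.
apply/implyP=> Rjj; move: not_self; rewrite /blocked_by_self in_CRU Rjj; lia.
Qed.

(** Mirror image of [lower_attained], with the two ends and the signs of v_j exchanged. *)
Lemma upper_attained j : exists2 x, (m <= x <= M)%O & (a x).@j = upper j.
Proof.
have [m0 mM MC] := state_bounds j; rewrite /upper.
case: ifPn => [alw | not_always]; first by apply: attained_always => //; lia.
have self := not_always_self not_always.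
case: ifPn => [other | not_other].
  case: ifPn => v_sgn; first by apply: attained_blocked; rewrite ?other //; lia.
  apply: (attained_free
    (z := if R j j then Num.min M.@j (C.@j - v.@j) else M.@j)) => //;
  by move: self; rewrite /clip; case: (R j j) => [/(_ isT)|]; lia.
case: ifPn => [/andP[jCR Rjj] | not_self].
  move: jCR (self Rjj); rewrite in_CRU => jCR jCR'; case: ifPn => v_sgn; last first.
    by apply: (attained_free (z := C.@j - v.@j)) => //; rewrite /clip; lia.
  have [le_mv | lt_mv] := leP (- v.@j - 1) (M.@j + v.@j).
    by apply: (attained_free (z := M.@j)) => //; rewrite /clip; lia.
  by apply: attained_blocked; rewrite ?Rjj; lia.
apply: (attained_free (z := M.@j)) => //; first by lia.
apply/implyP=> Rjj; move: not_self; rewrite /blocked_by_self in_CRU Rjj; lia.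
Qed.

Lemma envelope_bounds :
  envelope a m M [tuple lower j | j < d] [tuple upper j | j < d].
Proof.
split; split.
- move=> _ [x xP <-]; apply/vec_leP => j; rewrite tnth_mktuple.
  by case/andP: (ashe_in_bounds xP j).
- move=> y y_lb; apply/vec_leP => j; rewrite tnth_mktuple.
  (* The witness may depend on j, since the order is componentwise. *)
  have [x xP <-] := lower_attained j.
  by have /vec_leP := y_lb (a x) (ex_intro2 _ _ x xP erefl); apply.
- move=> _ [x xP <-]; apply/vec_leP => j; rewrite tnth_mktuple.
  by case/andP: (ashe_in_bounds xP j).
move=> y y_ub; apply/vec_leP => j; rewrite tnth_mktuple.
have [x xP <-] := upper_attained j.
by have /vec_leP := y_ub (a x) (ex_intro2 _ _ x xP erefl); apply.
Qed.

(** * The case distinction of the statement *)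

Lemma not_blocked j : j \notin B C v R m :|: B C v R M ->
  [/\ ~~ always_blocked j, ~~ blocked_by_other j & ~~ blocked_by_self j].
Proof.
have free i : R i j -> i \in CR C v m :|: CR C v M ->
    j \in B C v R m :|: B C v R M.
  move=> Rij; rewrite !finset.in_setU !in_B => /orP[] iCR; apply/orP; [left|right];
  by apply/existsP; exists i; rewrite iCR.
move=> notB; split; apply: contra notB.
- case/existsP=> i /andP[iCR Rij]; apply: (free i) => //.
  by move: iCR; rewrite finset.in_setI finset.in_setU => /andP[->].
- by case/existsP=> i /and3P[iCR Rij _]; apply: (free i).
- by case/andP=> jCR Rjj; apply: (free j).
Qed.

Lemma bounds_values j :
  [/\ v.@j = 0 -> lower j = m.@j /\ upper j = M.@j,
      j \notin B C v R m :|: B C v R M ->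
        lower j = clip (m.@j + v.@j) C.@j /\
        upper j = clip (M.@j + v.@j) C.@j,
      (exists2 i, i \in CR C v m :&: CR C v M & R i j) ->
        lower j = m.@j /\ upper j = M.@j
    & j \in B C v R m :|: B C v R M ->
      ~ (exists2 i, i \in CR C v m :&: CR C v M & R i j) ->
        ((exists i, [/\ i != j, i \in CR C v m :|: CR C v M & R i j]) ->
           (v.@j < 0 ->
              lower j = Num.max (m.@j + v.@j) 0 /\ upper j = M.@j) /\
           (0 < v.@j ->
              lower j = m.@j /\ upper j = Num.min (M.@j + v.@j) C.@j))
        /\
        ((forall i, i \in CR C v m :|: CR C v M -> R i j -> i = j) ->
           (v.@j < 0 ->
              lower j = 0 /\
              upper j = Num.max (M.@j + v.@j) (- v.@j - 1)) /\
           (0 < v.@j ->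
              lower j = Num.min (m.@j + v.@j) (C.@j - v.@j + 1) /\
              upper j = C.@j))].
Proof.
have [m0 mM MC] := state_bounds j.
split.
(* With v_j = 0 the self-blocking branch is impossible, as m_j and M_j lie in [0, C_j]; all others
   give m_j and M_j. *)
- move=> v0; rewrite /lower /upper /blocked_by_self in_CRU /clip v0 !lexx.
  by do ![case: ifP => ?]; split; lia.
- by move/not_blocked; rewrite /lower /upper => -[/negPf-> /negPf-> /negPf->].
- case=> i iCR Rij; rewrite /lower /upper ifT ?ifT //;
  by apply/existsP; exists i; rewrite iCR.
move=> jB not_always.
have /negPf alw : ~~ always_blocked j.
  by apply/negP => /existsP[i /andP[iCR Rij]]; apply: not_always; exists i.
rewrite /lower /upper alw; split=> [[i [neq_ij iCR Rij]] | only_self].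
  have -> : blocked_by_other j by apply/existsP; exists i; rewrite iCR Rij.
  by split=> v_sgn; [rewrite ltW | rewrite lt_geF].
have /negPf -> : ~~ blocked_by_other j.
  apply/negP => /existsP[i /and3P[iCR Rij]].
  by rewrite (only_self i) ?eqxx.
have -> : blocked_by_self j.
  (* Some i blocks j at m or at M, and [only_self] forces it to be j. *)
  have [i iU Rij] : exists2 i, i \in CR C v m :|: CR C v M & R i j.
    move: jB; rewrite finset.in_setU !in_B => /orP[] /existsP[i /andP[iCR Rij]];
    by exists i; rewrite // finset.in_setU iCR ?orbT.
  have eq_ij := only_self i iU Rij.
  by rewrite /blocked_by_self -{1}eq_ij iU -{1}eq_ij.
by split=> v_sgn; [rewrite ltW | rewrite lt_geF].
Qed.
End EnvelopeValues.

(** * Execution and cost of programs *)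

Lemma foldl_iota_ind (T : Type) (f : T -> nat -> T) (I : nat -> T -> Prop) n x :
    I 0%N x -> (forall k y, (k < n)%N -> I k y -> I k.+1 (f y k)) ->
  I n (foldl f x (iota 0 n)).
Proof.
move=> I0; elim: n => [//|n IHn] IS.
rewrite -addn1 iotaD foldl_cat /= addn1; apply: (IS) => //.
by apply: IHn => k y /ltnW; apply: IS.
Qed.

Lemma exec_Seq c1 c2 s :
  exec (Seq c1 c2) s = ((exec c2 (exec c1 s).1).1,
                        ((exec c1 s).2 + (exec c2 (exec c1 s).1).2)%N).
Proof. by rewrite /=; case: (exec c1 s) => s1 n1; case: (exec c2 s1). Qed.

Lemma exec_If e c1 c2 s :
  exec (If e c1 c2) s =
    let r := if eval s e != 0 then exec c1 s else exec c2 s in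
    (r.1, (r.2 + ecost e).+1).
Proof. by rewrite /=; case: ifP => _; case: exec. Qed.

(** Loop rule whose invariant sees both memory and cost, so that it serves correctness and
    complexity alike. *)
Lemma exec_For_ind (I : nat -> memory -> nat -> Prop) x e c s n :
    eval s e = n%:Z -> I 0%N s (ecost e).+1 ->
    (forall k s' q, (k < n)%N -> I k s' q ->
       let r := exec c (upd s' x 0 0 k%:Z) in I k.+1 r.1 (q + r.2).+1) ->
  I n (exec (For x e c) s).1 (exec (For x e c) s).2.
Proof.
move=> en I0 IS; rewrite /= en.
apply: (foldl_iota_ind (I := fun k st => I k st.1 st.2)) => // k [s' q] lt_kn Ik.
by have := IS k s' q lt_kn Ik; case: exec.
Qed.

Fixpoint writes (c : cmd) : seq nat :=
  match c with
  | Skip => [::]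
  | Set_ t _ _ _ => [:: t]
  | Seq c1 c2 | If _ c1 c2 => writes c1 ++ writes c2
  | For x _ c1 => x :: writes c1
  end.

(** [writes] is a syntactic upper bound for the tables that can change, loop counters included. *)
Lemma exec_frame c s t : t \notin writes c -> (exec c s).1 t =2 s t.
Proof.
elim: c s => [|x e1 e2 e3|c1 IH1 c2 IH2|e c1 IH1 c2 IH2|x e c IH] s.
- by [].
- by rewrite inE /= /upd => /negPf-> i j.
- rewrite mem_cat negb_or => /andP[nt1 nt2] i j.
  by rewrite exec_Seq /= IH2 ?IH1.
- rewrite mem_cat negb_or => /andP[nt1 nt2] i j.
  by rewrite exec_If; case: ifP => _ /=; rewrite (IH1, IH2).
rewrite inE negb_or => /andP[neq_tx nt] /=.
apply: (foldl_iota_ind (I := fun _ st => st.1 t =2 s t)) => // k [s' q] _ IHk i j.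
have := IH (upd s' x 0 0 k%:Z) nt i j.
by case: exec => /= s1 _ ->; rewrite /upd (negPf neq_tx); apply: IHk.
Qed.

(** * Polynomial cost bound *)

Definition dim_cell := Cell tab_dim (Cst 0) (Cst 0).

Fixpoint dim_loops (c : cmd) : Prop :=
  match c with
  | Skip | Set_ _ _ _ _ => True
  | Seq c1 c2 | If _ c1 c2 => dim_loops c1 /\ dim_loops c2
  | For _ e c1 => e = dim_cell /\ dim_loops c1
  end.

Fixpoint depth (c : cmd) : nat :=
  match c with
  | Skip | Set_ _ _ _ _ => 0
  | Seq c1 c2 | If _ c1 c2 => maxn (depth c1) (depth c2)
  | For _ _ c1 => (depth c1).+1
  end.

(** The cost if each loop made one iteration and both branches of a conditional were charged; the 2
    in [For] counts the loop and its single step. *)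
Fixpoint cmd_size (c : cmd) : nat :=
  match c with
  | Skip => 1
  | Set_ _ i j e => (ecost i + ecost j + ecost e).+1
  | Seq c1 c2 => cmd_size c1 + cmd_size c2
  | If e c1 c2 => (cmd_size c1 + cmd_size c2 + ecost e).+1
  | For _ e c1 => (ecost e + cmd_size c1).+2
  end.

(** Each level of nesting multiplies the cost by at most d up to constants absorbed in [cmd_size].
    As d > 0, its powers increase, so all parts of a program can share the maximal depth. *)
Lemma exec_cost c s d : (0 < d)%N -> tab_dim \notin writes c -> dim_loops c ->
  s tab_dim 0 0 = d%:Z -> ((exec c s).2 <= cmd_size c * d ^ depth c)%N.
Proof.
move=> d_gt0; have le_exp k l : (k <= l)%N -> (d ^ k <= d ^ l)%N.
  by move=> le_kl; rewrite leq_pexp2l.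
have exp_gt0 k : (0 < d ^ k)%N by rewrite expn_gt0 d_gt0.
elim: c s => [|x e1 e2 e3|c1 IH1 c2 IH2|e c1 IH1 c2 IH2|x e c IH] s.
- by [].
- by rewrite /= muln1.
- rewrite mem_cat negb_or => /andP[nt1 nt2] [l1 l2] s_dim; rewrite exec_Seq /= mulnDl.
  apply: leq_add.
    by apply: leq_trans (IH1 _ nt1 l1 s_dim) _; rewrite leq_mul // le_exp ?leq_maxl.
  apply: leq_trans (IH2 _ nt2 l2 _) _; first by rewrite exec_frame.
  by rewrite leq_mul // le_exp ?leq_maxr.
- rewrite mem_cat negb_or => /andP[nt1 nt2] [l1 l2] s_dim; rewrite exec_If /=.
  have := IH1 _ nt1 l1 s_dim; have := IH2 _ nt2 l2 s_dim.
  have := le_exp _ _ (leq_maxl (depth c1) (depth c2)).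
  have := le_exp _ _ (leq_maxr (depth c1) (depth c2)).
  have := exp_gt0 (maxn (depth c1) (depth c2)).
  by case: ifP => _; nia.
rewrite inE negb_or => /andP[neq_tx nt] [-> l] s_dim.
pose q0 := (ecost dim_cell).+1; pose b := (cmd_size c * d ^ depth c)%N.
have [_] : (exec (For x dim_cell c) s).1 tab_dim 0 0 = d%:Z /\
           ((exec (For x dim_cell c) s).2 <= q0 + d * b.+1)%N.
  apply: (exec_For_ind (I := fun k s' q =>
    s' tab_dim 0 0 = d%:Z /\ (q <= q0 + k * b.+1)%N)) => //.
  move=> k s' q _ [s'_dim le_q] r.
  have upd_dim : upd s' x 0 0 k%:Z tab_dim 0 0 = d%:Z by rewrite /upd (negPf neq_tx).
  split; first by rewrite exec_frame.
  have := IH _ nt l upd_dim; rewrite -/r -/b; lia.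
move=> le_q; apply: leq_trans le_q _; rewrite /= expnS /q0 /b /=.
have := exp_gt0 (depth c); nia.
Qed.

(** * Truth values as integers and bounded search *)

Definition flag (b : bool) : int := if b then 1 else 0.

Lemma flag_conj a b : Num.min (flag a) (flag b) = flag (a && b).
Proof. by case: a; case: b. Qed.

Lemma flag_disj a b : Num.max (flag a) (flag b) = flag (a || b).
Proof. by case: a; case: b. Qed.

Lemma flag_neg a : 1 - flag a = flag (~~ a).
Proof. by case: a. Qed.

Lemma flag_neq0 a : (flag a != 0) = a.
Proof. by case: a. Qed.

Definition flagE := (flag_conj, flag_disj, flag_neg, flag_neq0).

Definition exists_cmd (x f : nat) (e : expr) : cmd :=
  Seq (Set_ f (Cst 0) (Cst 0) (Cst 0))
      (For x dim_cell
         (Set_ f (Cst 0) (Cst 0) (Bin Max (Cell f (Cst 0) (Cst 0)) e))).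

(** On flags, [Max] accumulates a disjunction. The test [e] is evaluated in memories met during the
    loop, which differ from [s] only in the counter and flag tables; hence the quantification over
    [s']. *)
Lemma exists_cmdP d (b : pred 'I_d) x f e s :
    x != f -> tab_dim \notin [:: x; f] -> s tab_dim 0 0 = d%:Z ->
    (forall (i : 'I_d) s', (forall t, t \notin [:: x; f] -> s' t =2 s t) ->
       s' x 0 0 = i%:Z -> eval s' e = flag (b i)) ->
  (exec (exists_cmd x f e) s).1 f 0 0 = flag [exists i, b i].
Proof.
move=> neq_xf dim_xf s_dim eP.
pose I k s' (_ : nat) := (forall t, t \notin [:: x; f] -> s' t =2 s t) /\
  s' f 0 0 = flag [exists i : 'I_d, (i < k)%N && b i].
rewrite exec_Seq [fst (pair _ _)]/fst.
set s0 := (exec (Set_ _ _ _ _) s).1; set c := Set_ f _ _ (Bin _ _ _).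
have s0P t : t \notin [:: x; f] -> s0 t =2 s t.
  by rewrite !inE negb_or => /andP[_ nt] i j; rewrite /s0 exec_frame ?inE.
have [|||_ ->] := @exec_For_ind I x dim_cell c s0 d.
- by rewrite /= s0P.
- split=> //; rewrite /s0 /= /upd !eqxx.
  by case: existsP => // -[i].
- move=> k s' q lt_kd [IHs IHf]; split=> [t nt i j|].
    have := nt; rewrite !inE negb_or => /andP[ntx ntf].
    rewrite exec_frame ?inE // /upd (negPf ntx); exact: IHs.
  set s1 := upd _ _ _ _ _; rewrite /= {1}/upd !eqxx /=.
  rewrite (eP (Ordinal lt_kd)); first last.
  - by rewrite /s1 /upd !eqxx.
  - move=> t nt i j; have := nt; rewrite !inE negb_or => /andP[ntx _].
    by rewrite /s1 /upd (negPf ntx); apply: IHs.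
  rewrite /s1 /upd eq_sym (negPf neq_xf) IHf flagE; congr flag.
  apply/orP/existsP => [[/existsP[i /andP[lt_ik bi]] | bk] | [i /andP[]]].
  - by exists i; rewrite ltnW.
  - by exists (Ordinal lt_kd); rewrite ltnSn.
  rewrite ltnS leq_eqVlt => /orP[/eqP eq_ik bi | lt_ik bi]; [right | left].
    by move: bi; congr b; apply: val_inj.
  by apply/existsP; exists i; rewrite lt_ik.
by congr flag; apply: eq_existsb => i; rewrite ltn_ord.
Qed.
Lemma exists_cmd_frame x f e s t :
  t \notin [:: x; f] -> (exec (exists_cmd x f e) s).1 t =2 s t.
Proof. by move=> nt; apply: exec_frame; rewrite /= !inE orbCA orbb -mem_seq2. Qed.

(** * The program *)

Definition tab_i : nat := 8.
Definition tab_j : nat := 9.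
Definition tab_always : nat := 10.
Definition tab_other : nat := 11.

Definition scalar (t : nat) : expr := Cell t (Cst 0) (Cst 0).
Definition entry (t k : nat) : expr := Cell t (scalar k) (Cst 0).
Definition neg (e : expr) : expr := Bin Defs.Sub (Cst 1) e.

Definition within (t k : nat) : expr :=
  let z := Bin Add (entry t k) (entry tab_v k) in
  Bin Min (Bin Leq (Cst 0) z) (Bin Leq z (entry tab_C k)).

Definition CRI_expr (k : nat) : expr :=
  Bin Min (neg (within tab_m k)) (neg (within tab_M k)).

Definition CRU_expr (k : nat) : expr :=
  Bin Max (neg (within tab_m k)) (neg (within tab_M k)).

Definition R_expr (k l : nat) : expr := Cell tab_R (scalar k) (scalar l).

Definition neq_expr (k l : nat) : expr :=
  neg (Bin Min (Bin Leq (scalar k) (scalar l)) (Bin Leq (scalar l) (scalar k))).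

Definition always_expr : expr := Bin Min (CRI_expr tab_i) (R_expr tab_i tab_j).

Definition other_expr : expr :=
  Bin Min (CRU_expr tab_i) (Bin Min (R_expr tab_i tab_j) (neq_expr tab_i tab_j)).

Definition self_expr : expr := Bin Min (CRU_expr tab_j) (R_expr tab_j tab_j).

Definition clip_expr (t : nat) : expr :=
  Bin Min (Bin Max (Bin Add (entry t tab_j) (entry tab_v tab_j)) (Cst 0))
          (entry tab_C tab_j).

Definition store_bounds (e e' : expr) : cmd :=
  Seq (Set_ tab_m' (scalar tab_j) (Cst 0) e)
      (Set_ tab_M' (scalar tab_j) (Cst 0) e').

(** Two successive scans over i, then tests in the order of [lower] and [upper]. Neither scan is
    nested in the other, so the outer loop over j gives depth 2. *)
Definition column_cmd : cmd :=
  let m := entry tab_m tab_j in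
  let M := entry tab_M tab_j in
  let v := entry tab_v tab_j in
  let C := entry tab_C tab_j in
  let v_le0 := Bin Leq v (Cst 0) in
  Seq (exists_cmd tab_i tab_always always_expr)
 (Seq (exists_cmd tab_i tab_other other_expr)
 (If (scalar tab_always)
   (store_bounds m M)
 (If (scalar tab_other)
   (If v_le0
     (store_bounds (Bin Max (Bin Add m v) (Cst 0)) M)
     (store_bounds m (Bin Min (Bin Add M v) C)))
 (If self_expr
   (If v_le0
     (store_bounds (Cst 0)
        (Bin Max (Bin Add M v) (Bin Defs.Sub (Bin Defs.Sub (Cst 0) v) (Cst 1))))
     (store_bounds (Bin Min (Bin Add m v) (Bin Add (Bin Defs.Sub C v) (Cst 1))) C))
   (store_bounds (clip_expr tab_m) (clip_expr tab_M)))))).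

Definition envelope_cmd : cmd := For tab_j dim_cell column_cmd.

(** * Correctness of the program *)

Section Correctness.
Variables (d : nat) (C v : vec d) (R : rel 'I_d) (m M : vec d).

(** The input occupies the tables up to [tab_M]; output and working tables come after it. *)
Lemma input_eq s s' : (forall t, (t <= tab_M)%N -> s' t =2 s t) ->
  input C v R m M s -> input C v R m M s'.
Proof.
move=> eq_s [s_dim [s_C s_v] [s_m s_M] s_R].
by split; [|split=> i|split=> i|move=> i j]; rewrite eq_s ?s_C ?s_v ?s_m ?s_M ?s_R.
Qed.

Section Eval.
Variables (s : memory) (k : nat) (j : 'I_d).
Hypotheses (s_input : input C v R m M s) (s_j : s k 0 0 = j%:Z).

Lemma eval_within :
  eval s (within tab_m k) = flag (0 <= m.@j + v.@j <= C.@j) /\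
  eval s (within tab_M k) = flag (0 <= M.@j + v.@j <= C.@j).
Proof.
case: s_input => _ [s_C s_v] [s_m s_M] _; rewrite /= s_j s_C s_v s_m s_M.
by split; case: (0 <= _); case: (_ <= C.@j).
Qed.

Lemma eval_CRI : eval s (CRI_expr k) = flag (j \in CR C v m :&: CR C v M).
Proof.
rewrite in_CRI -flag_conj -!flag_neg; case: eval_within => <- <-; exact: erefl.
Qed.

Lemma eval_CRU : eval s (CRU_expr k) = flag (j \in CR C v m :|: CR C v M).
Proof.
rewrite in_CRU -flag_disj -!flag_neg; case: eval_within => <- <-; exact: erefl.
Qed.
End Eval.

Lemma eval_R s k l (i j : 'I_d) : input C v R m M s ->
  s k 0 0 = i%:Z -> s l 0 0 = j%:Z -> eval s (R_expr k l) = flag (R i j).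
Proof. by case=> _ _ _ s_R s_i s_j; rewrite /= s_i s_j s_R. Qed.

Lemma eval_neq s k l (i j : 'I_d) :
  s k 0 0 = i%:Z -> s l 0 0 = j%:Z -> eval s (neq_expr k l) = flag (i != j).
Proof.
move=> s_i s_j; rewrite /= s_i s_j -val_eqE /flag /=.
by rewrite !lez_nat; case: (ltngtP i j).
Qed.

(** Quantifying over all indices i also records that entries other than j survive, which the outer
    loop needs for the results already stored. *)
Lemma column_cmdP s (j : 'I_d) :
    input C v R m M s -> s tab_j 0 0 = j%:Z ->
  let s' := (exec column_cmd s).1 in
  (forall i, s' tab_m' i 0 =
             if i == j%:Z then lower C v R m M j else s tab_m' i 0) /\
  (forall i, s' tab_M' i 0 =
             if i == j%:Z then upper C v R m M j else s tab_M' i 0).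
Proof.
move=> s_input s_j; rewrite /column_cmd.
set c0 := exists_cmd _ _ _; set c1 := exists_cmd _ _ _; set c2 := If _ _ _.
rewrite (exec_Seq c0) (exec_Seq c1); cbn [fst].
set s1 := (exec c0 s).1; set s2 := (exec c1 s1).1.
have s1E t : t \notin [:: tab_i; tab_always] -> s1 t =2 s t.
  exact: exists_cmd_frame.
have s2E t : t \notin [:: tab_i; tab_other] -> s2 t =2 s1 t.
  exact: exists_cmd_frame.
have s1_input : input C v R m M s1.
  by apply: input_eq s_input => -[|[|[|[|[|[|t]]]]]] // _; apply: s1E.
have s2_input : input C v R m M s2.
  by apply: input_eq s1_input => -[|[|[|[|[|[|t]]]]]] // _; apply: s2E.
have s1_always : s1 tab_always 0 0 = flag (always_blocked C v R m M j).
  apply: exists_cmdP => //; first by case: s_input.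
  move=> i s' s'E s'_i.
  have s'_input : input C v R m M s'.
    by apply: input_eq s_input => -[|[|[|[|[|[|t]]]]]] // _; apply: s'E.
  have s'_j : s' tab_j 0 0 = j%:Z by rewrite s'E.
  rewrite -flag_conj -(eval_CRI s'_input s'_i) -(eval_R s'_input s'_i s'_j).
  exact: erefl.
have s2_other : s2 tab_other 0 0 = flag (blocked_by_other C v R m M j).
  apply: exists_cmdP => //; first by case: s1_input.
  move=> i s' s'E s'_i.
  have s'_input : input C v R m M s'.
    by apply: input_eq s1_input => -[|[|[|[|[|[|t]]]]]] // _; apply: s'E.
  have s'_j : s' tab_j 0 0 = j%:Z by rewrite s'E // s1E.
  rewrite -!flag_conj -(eval_CRU s'_input s'_i) -(eval_R s'_input s'_i s'_j).
  by rewrite -(eval_neq s'_i s'_j).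
have s2_always : s2 tab_always 0 0 = flag (always_blocked C v R m M j).
  by rewrite s2E.
have s2_j : s2 tab_j 0 0 = j%:Z by rewrite s2E // s1E.
have s2_self : eval s2 self_expr = flag (blocked_by_self C v R m M j).
  rewrite -flag_conj -(eval_CRU s2_input s2_j) -(eval_R s2_input s2_j s2_j).
  exact: erefl.
(* The second expression is evaluated after the first result has been written, hence in the updated
   memory. *)
have store e e' l u : eval s2 e = l ->
    eval (upd s2 tab_m' j%:Z 0 l) e' = u ->
    (exec (store_bounds e e') s2).1 = upd (upd s2 tab_m' j%:Z 0 l) tab_M' j%:Z 0 u.
  by move=> <- <-; rewrite exec_Seq /= s2_j /upd /= s2_j.
suff -> : (exec c2 s2).1 = upd (upd s2 tab_m' j%:Z 0 (lower C v R m M j))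
                               tab_M' j%:Z 0 (upper C v R m M j).
  by split=> i; rewrite /upd /= eqxx andbT s2E // s1E.
case: s2_input => _ [s_C s_v] [s_m s_M] _.
have v_le0 : eval s2 (Bin Leq (entry tab_v tab_j) (Cst 0)) = flag (v.@j <= 0).
  by rewrite /= s2_j s_v.
have reads := (s2_j, s_C, s_v, s_m, s_M, sub0r).
rewrite /c2 /lower /upper exec_If [eval s2 (scalar _)]/= s2_always flag_neq0.
case: always_blocked; first by apply: store; rewrite /= /upd /= !reads.
rewrite exec_If [eval s2 (scalar _)]/= s2_other flag_neq0.
case: blocked_by_other.
  rewrite exec_If v_le0 flag_neq0.
  by case: ifP => _; apply: store; rewrite /= /upd /= !reads.
rewrite exec_If s2_self flag_neq0.
case: blocked_by_self; last by apply: store; rewrite /= /upd /= !reads.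
rewrite exec_If v_le0 flag_neq0.
by case: ifP => _; apply: store; rewrite /= /upd /= ?reads.
Qed.

Lemma envelope_cmdP s : input C v R m M s ->
  forall j : 'I_d, (exec envelope_cmd s).1 tab_m' j%:Z 0 = lower C v R m M j /\
                   (exec envelope_cmd s).1 tab_M' j%:Z 0 = upper C v R m M j.
Proof.
move=> s_input.
have [|||_ outputs j] := @exec_For_ind (fun k s' _ => input C v R m M s' /\
    forall j : 'I_d, (j < k)%N -> s' tab_m' j%:Z 0 = lower C v R m M j /\
                               s' tab_M' j%:Z 0 = upper C v R m M j)
  tab_j dim_cell column_cmd s d; last by apply: outputs.
- by case: s_input.
- by split.
move=> k s' _ lt_kd [s'_input outputs].
set s1 := upd _ _ _ _ _.
have s1_input : input C v R m M s1.
  by apply: input_eq s'_input => -[|[|[|[|[|[|t]]]]]].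
have [eq_m eq_M] := @column_cmdP s1 (Ordinal lt_kd) s1_input erefl.
split=> [|j].
  apply: input_eq s1_input => t le_t i j; rewrite exec_frame //.
  by move: t le_t => [|[|[|[|[|[|t]]]]]].
rewrite ltnS leq_eqVlt eq_m eq_M => /orP[/eqP eq_jk | lt_jk].
  rewrite eq_jk eqxx; suff -> : j = Ordinal lt_kd by [].
  exact: val_inj.
by rewrite eqz_nat ltn_eqF //; apply: outputs.
Qed.
End Correctness.

Theorem theorem3 :
  exists (P : cmd) (K : nat),
  forall (d : nat) (C v : vec d) (R : rel 'I_d) (a : vec d -> vec d)
         (m M : vec d),
    (0 < d)%N ->
    ashe C v R a ->
    states C m -> states C M -> (m <= M)%O ->
  exists m' M' : vec d,
  [/\ envelope a m M m' M',
      (* computation in O(d^2) elementary operations, by a program P and with a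
         constant K that do not depend on d or on the data *)
      (forall s : memory, input C v R m M s ->
         [/\ stores (exec P s).1 tab_m' m',
             stores (exec P s).1 tab_M' M'
           & ((exec P s).2 <= K * d ^ 2)%N])
    & (* explicit values *)
      forall j : 'I_d,
      [/\ v.@j = 0 -> m'.@j = m.@j /\ M'.@j = M.@j,
          j \notin B C v R m :|: B C v R M ->
            m'.@j = clip (m.@j + v.@j) C.@j /\
            M'.@j = clip (M.@j + v.@j) C.@j,
          (exists2 i, i \in CR C v m :&: CR C v M & R i j) ->
            m'.@j = m.@j /\ M'.@j = M.@j
        & j \in B C v R m :|: B C v R M ->
          ~ (exists2 i, i \in CR C v m :&: CR C v M & R i j) ->
            ((exists i, [/\ i != j, i \in CR C v m :|: CR C v M & R i j]) ->
               (v.@j < 0 ->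
                  m'.@j = Num.max (m.@j + v.@j) 0 /\ M'.@j = M.@j) /\
               (0 < v.@j ->
                  m'.@j = m.@j /\ M'.@j = Num.min (M.@j + v.@j) C.@j))
            /\
            ((forall i, i \in CR C v m :|: CR C v M -> R i j -> i = j) ->
               (v.@j < 0 ->
                  m'.@j = 0 /\
                  M'.@j = Num.max (M.@j + v.@j) (- v.@j - 1)) /\
               (0 < v.@j ->
                  m'.@j = Num.min (m.@j + v.@j) (C.@j - v.@j + 1) /\
                  M'.@j = C.@j))]].
Proof.
exists envelope_cmd, (cmd_size envelope_cmd).
move=> d C v R a m M d_gt0 a_ashe m_state M_state le_mM.
exists [tuple lower C v R m M j | j < d], [tuple upper C v R m M j | j < d].
split=> [|s s_input|j]; first exact: envelope_bounds.
  split=> [j|j|]; rewrite ?tnth_mktuple.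
  - by case: (envelope_cmdP s_input j).
  - by case: (envelope_cmdP s_input j).
  (* The exponent 2 is [depth envelope_cmd], by computation. *)
  by apply: (exec_cost d_gt0); [| |case: s_input].
by rewrite !tnth_mktuple; apply: bounds_values.
Qed.
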